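(* Let $\lambda$ be a regular cardinal such that $\mu^+<\lambda<\mu^{\aleph_0}$ for some cardinal $\mu$, let $p$ be a prime and let $\mathbf t$ be the $p$-type. Then for every torsion-free homogeneous group $G$ of type $\mathbf t$ and cardinality $\lambda$ there is a torsion-free homogeneous group $H$ of type $\mathbf t$ and cardinality $\lambda$ which is not isomorphic to any pure subgroup of $G$. In particular, there is no purely universal group in $\lambda$ for the class of torsion-free homogeneous groups of type $\mathbf t$.
   Context: Groups are abelian. A subgroup $H\subseteq G$ is pure if $mH=mG\cap H$ for all natural $m$, where $mG=\{mg:g\in G\}$. Let $p_1,p_2,\dots$ enumerate the primes. For $g$ in a torsion-free group $G$, the $q$-height of $g$ is the largest $k$ with $g\in q^kG$ ($\infty$ if $g\in q^kG$ for all $k$); the characteristic of $g$ is $(k_1,k_2,\dots)$ with $k_l$ the $p_l$-height of $g$. A type is an equivalence class of characteristics, two being equivalent if they differ in only finitely many coordinates and only at coordinates where both are finite. $G$ is homogeneous of type $\mathbf t$ if every nonzero element has type $\mathbf t$. The $p$-type is the type of the characteristic that is $0$ at the coordinate of $p$ and $\infty$ elsewhere. A group $G$ in a class $K$ is purely universal for $K$ in $\lambda$ if $|G|=\lambda$ and every $H\in K$ with $|H|\le\lambda$ is isomorphic to a pure subgroup of $G$. *)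

(* Defs.v *)
From HB Require Import structures.
From mathcomp Require Import all_boot all_order all_algebra.
From mathcomp Require Import boolp classical_sets functions cardinality.
From mathcomp Require wochoice.
Set Implicit Arguments.
Unset Strict Implicit.
Unset Printing Implicit Defensive.
Import GRing.Theory.
Local Open Scope classical_set_scope.
Local Open Scope card_scope.
Local Open Scope ring_scope.

(* Cardinals are represented by types (mu stands for |mu|) and compared through
   the cardinality of their full sets; they may be finite unless an infinitude
   hypothesis is stated. *)

Definition card_lt T U (A : set T) (B : set U) : Prop :=
  A #<= B /\ ~ (B #<= A).

(* nu = mu^+, the least cardinal greater than mu *)
Definition successor_cardinal (mu nu : Type) : Prop :=
  card_lt [set: mu] [set: nu] /\
  forall X : Type, card_lt [set: mu] [set: X] -> [set: nu] #<= [set: X].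

(* The well-order R (reflexive, as in wochoice) makes L an initial ordinal,
   i.e. identifies L with the cardinal |L|. *)
Definition initial_well_order (L : Type) (R : rel L) : Prop :=
  wochoice.well_order R /\
  forall x : L, card_lt [set y | R y x /\ y <> x] [set: L].

Definition cofinal (L : Type) (R : rel L) (C : set L) : Prop :=
  forall x : L, exists2 y, C y & R x y.

(* |L| is infinite and equal to its cofinality. An initial well-order of L
   exists by choice and is unique up to isomorphism, so that quantifying it
   existentially or universally makes no difference. *)
Definition regular_cardinal (L : Type) : Prop :=
  infinite_set [set: L] /\
  exists R : rel L, initial_well_order R /\
    forall C : set L, cofinal R C -> C #= [set: L].

Section Groups.
Variable G : zmodType.

Definition torsion_free : Prop :=
  forall (n : nat) (g : G), (0 < n)%N -> g *+ n = 0 -> g = 0.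

Definition multiples (m : nat) (A : set G) : set G :=
  [set g *+ m | g in A].

Definition pure_subgroup (A : set G) : Prop :=
  zmod_closed [in A] /\
  forall m : nat, multiples m A = multiples m [set: G] `&` A.

(* None encodes the height oo *)
Definition is_height (q : nat) (g : G) (h : option nat) : Prop :=
  match h with
  | Some k => multiples (q ^ k) [set: G] g /\
      forall j, multiples (q ^ j) [set: G] g -> (j <= k)%N
  | None => forall j, multiples (q ^ j) [set: G] g
  end.

(* is_height q g holds of exactly one h, so the default value is irrelevant *)
Definition height (q : nat) (g : G) : option nat :=
  xget None [set h | is_height q g h].

End Groups.

(* Coordinates are indexed by the primes themselves *)
Definition prime_number := {q : nat | prime q}.

Definition characteristic := prime_number -> option nat.

Definition characteristic_of (G : zmodType) (g : G) : characteristic :=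
  fun q => height (val q) g.

Definition char_equiv (chi chi' : characteristic) : Prop :=
  finite_set [set q | chi q <> chi' q] /\
  forall q, chi q <> chi' q -> chi q <> None /\ chi' q <> None.

(* A type is an equivalence class of characteristics *)
Definition type_class (chi : characteristic) : set characteristic :=
  [set chi' | char_equiv chi chi'].

Definition homogeneous (t : set characteristic) (G : zmodType) : Prop :=
  forall g : G, g <> 0 -> type_class (characteristic_of g) = t.

Definition p_type (p : nat) : set characteristic :=
  type_class (fun q => if val q == p then Some 0%N else None).

Definition tf_homogeneous (t : set characteristic) (G : zmodType) : Prop :=
  torsion_free G /\ homogeneous t G.

Definition isomorphic_to_pure_subgroup (H G : zmodType) : Prop :=
  exists A : set G, pure_subgroup A /\
    exists f : {additive H -> G}, set_bij [set: H] A f.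

Definition purely_universal (K : zmodType -> Prop) (L : Type) (G : zmodType)
    : Prop :=
  [/\ K G, [set: G] #= [set: L] &
      forall H : zmodType, K H -> [set: H] #<= [set: L] ->
        isomorphic_to_pure_subgroup H G].

(* Main.v *)
(* Torsion-free homogeneous groups of p-type are the reduced torsion-free modules over
   Z_(p), and a pure embedding h preserves p-adic distances.

   If mu is finite then lambda < 2^aleph_0. A p-adic integer x is determined by any pair
   (g, x g) of elements of G with g outside pG, so some irrational x occurs for no pair in G; the
   pure closure of <1, x> in the p-adic integers, plus a free module of rank lambda, is H.

   If mu is infinite, let M be the least initial segment of lambda of cardinality greater than
   mu. Iterating M times proves a club guessing principle: there are lambda sets c_i, each
   consisting of omega consecutive blocks indexed by mu, such that every club of lambda contains
   some c_i. Enumerate G in order type lambda. The p-adic distances from g in G to the initial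
   segments of G cut at points of c_i determine at most one s : nat -> mu; since
   lambda < mu^aleph_0, some s_i is determined by no g. Let H be the pure closure of the span of
   the x_a (a < lambda) and of the y_i = sum_n p^n x_{c_i(n, s_i n)}. If h : H -> G is pure, then
   at the points of a club the distances from h(y_i) to the initial segments of G agree with
   those from y_i to the span of the corresponding x_a; if that club contains c_i, then h(y_i)
   determines s_i, a contradiction. *)
From HB Require Import structures.
Require Import Defs.
From mathcomp Require Import all_boot all_order all_algebra.
From mathcomp Require Import boolp classical_sets functions cardinality.
From mathcomp Require Import ring zify.
From mathcomp Require wochoice.
From Stdlib Require Inverse_Image.
Set Implicit Arguments.
Unset Strict Implicit.
Unset Printing Implicit Defensive.
Import GRing.Theory Num.Theory.
Local Open Scope classical_set_scope.
Local Open Scope card_scope.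

(** * Cardinal arithmetic *)

Definition embeds (A B : Type) : Prop := exists f : A -> B, injective f.

Lemma card_leTP (A B : Type) : [set: A] #<= [set: B] <-> embeds A B.
Proof.
split.
- move=> /card_leP[f].
  exists (fun x => val (f (SigSub (mem_set (I : [set: A] x))))) => x y /val_inj.
  by move=> /(inj (mem_set I) (mem_set I)) [].
- case=> f injf; apply/card_le_trans/(subset_card_le (@subsetT _ (range f))).
  by have /card_eqPle[] : range f #= [set: A] by apply: inj_card_eq => x y _ _; exact: injf.
Qed.

Lemma embeds_refl (A : Type) : embeds A A. Proof. by exists id. Qed.

Lemma embeds_trans (A B C : Type) : embeds A B -> embeds B C -> embeds A C.
Proof. by move=> [f fi] [g gi]; exists (g \o f); apply: inj_comp. Qed.

Lemma embeds_surj (A B : Type) (f : A -> B) : (forall b, exists a, f a = b) -> embeds B A.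
Proof.
by move=> /choice[g fg]; exists g; apply: can_inj fg.
Qed.

Lemma embeds_prod (A B C D : Type) : embeds A B -> embeds C D -> embeds (A * C) (B * D).
Proof.
move=> [f fi] [g gi]; exists (fun z => (f z.1, g z.2)) => -[a c] [a' c'] /=.
by case=> /fi -> /gi ->.
Qed.

Lemma embeds_sig (A : Type) (D E : A -> Prop) : (forall x, D x -> E x) ->
  embeds {x | D x} {x | E x}.
Proof.
move=> DE; exists (fun x => exist _ (sval x) (DE _ (proj2_sig x))).
by move=> [x Dx] [y Dy] /= [xy]; apply: eq_exist.
Qed.

Lemma embeds_sval (A : Type) (D : A -> Prop) : embeds {x | D x} A.
Proof. by exists sval => -[x Dx] [y Dy] /= xy; apply: eq_exist. Qed.


Lemma wf_build (A B : Type) (lt : A -> A -> Prop) (b0 : B)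
    (P : A -> (A -> B) -> B -> Prop) :
  well_founded lt ->
  (forall a h h' b, (forall a', lt a' a -> h a' = h' a') -> P a h b -> P a h' b) ->
  (forall a h, exists b, P a h b) ->
  exists g : A -> B, forall a, P a g (g a).
Proof.
move=> wf ext ex.
have [|next nextP] := @choice (A * (A -> B)) B (fun ah b => P ah.1 ah.2 b).
  by move=> [a h]; apply: ex.
pose below a (r : forall a', lt a' a -> B) a' :=
  if pselect (lt a' a) is left h then r a' h else b0.
pose g := Fix wf (fun _ => B) (fun a r => next (a, below a r)).
have gE a : g a = next (a, below a (fun a' _ => g a')).
  rewrite /g Fix_eq // => x f f' ff'; congr (next (_, _)).
  by apply/funext => y; rewrite /below; case: pselect.
exists g => a; rewrite [X in P _ _ X]gE.
apply: (ext _ _ _ _ _ (nextP (a, below a (fun a' _ => g a')))) => a' lta /=.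
by rewrite /below; case: pselect.
Qed.

(** * Strict well-orders *)

Record strict_wo (T : Type) (lt : T -> T -> Prop) : Prop := StrictWo {
  swo_wf : well_founded lt;
  swo_trans : forall y x z, lt x y -> lt y z -> lt x z;
  swo_tot : forall x y, [\/ lt x y, x = y | lt y x] }.

Section StrictWo.
Variables (T : Type) (lt : T -> T -> Prop) (wo : strict_wo lt).

Lemma swo_irr x : ~ lt x x.
Proof.
by elim/(well_founded_ind (swo_wf wo)): x => x IH ltx; apply: (IH _ ltx ltx).
Qed.

Lemma swo_asym x y : lt x y -> ~ lt y x.
Proof. by move=> xy yx; apply: (@swo_irr x); apply: swo_trans yx. Qed.

Lemma swo_nlt x y : ~ lt x y <-> y = x \/ lt y x.
Proof.
split.
  by case: (swo_tot wo x y) => [//|->|]; [left|right].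
by case=> [->|/swo_asym//]; apply: swo_irr.
Qed.

Lemma swo_le_lt y x z : ~ lt y x -> lt y z -> lt x z.
Proof. by move=> /swo_nlt[->//|xy]; apply: swo_trans. Qed.

Lemma swo_lt_le y x z : lt x y -> ~ lt z y -> lt x z.
Proof. by move=> xy /swo_nlt[<-//|]; apply: swo_trans. Qed.

Lemma swo_least (P : T -> Prop) : (exists x, P x) ->
  exists2 x, P x & forall y, P y -> ~ lt y x.
Proof.
move=> exP; apply: contrapT => no.
have nP x : ~ P x.
  elim/(well_founded_ind (swo_wf wo)): x => x IH Px.
  by apply: no; exists x => // y Py /IH.
by case: exP => x /nP.
Qed.

Lemma swo_pull (S : Type) (f : S -> T) : injective f ->
  strict_wo (fun x y => lt (f x) (f y)).
Proof.
move=> fi; split.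
- exact: (Inverse_Image.wf_inverse_image _ _ _ f (swo_wf wo)).
- by move=> y x z; apply: swo_trans.
- move=> x y; case: (swo_tot wo (f x) (f y)) => [|/fi|];
    by [constructor 1|constructor 2|constructor 3].
Qed.

End StrictWo.

(** [wochoice.well_order] provides unique minima of nonempty sets; the order axioms follow from the
    minima of sets of one, two and three points. *)
Lemma swo_well_order (T : Type) (R : rel T) :
  wochoice.well_order R -> strict_wo (fun x y => R x y /\ x <> y).
Proof.
move=> Rwo.
have least (P : T -> Prop) : (exists x, P x) -> exists2 x, P x & forall y, P y -> R x y.
  move=> [x Px]; have [|z [[/asboolP Pz zmin] _]] := Rwo [pred y | `[< P y >]].
    by exists x; apply/asboolP.
  by exists z => // y Py; apply: zmin; apply/asboolP.
have anti x y : R x y -> R y x -> x = y.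
  move=> xy yx; have [|z [_ zu]] := Rwo [pred t | `[< t = x \/ t = y >]].
    by exists x; apply/asboolP; left.
  have rxx t : R t t.
    by have [|u tu tmin] := least (fun y => t = y); [exists t|rewrite {1}tu; apply: tmin].
  have <- : z = x.
    by apply: zu; split=> [|t /asboolP[]->//]; apply/asboolP; left.
  by apply: zu; split=> [|t /asboolP[]->//]; apply/asboolP; right.
split.
- move=> x; apply: contrapT => nx.
  have [|y ny ymin] := least (fun y => ~ Acc (fun x y => R x y /\ x <> y) y).
    by exists x.
  apply: ny; constructor=> z [zy nzy]; apply: contrapT => nz.
  by apply: nzy; apply: anti => //; apply: ymin.
- move=> y x z [xy nxy] [yz nyz].
  have [|m mE mmin] := least (fun t => [\/ t = x, t = y | t = z]).
    by exists x; constructor 1.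
  have mx := mmin x (Or31 _ _ erefl); have my := mmin y (Or32 _ _ erefl).
  have mz := mmin z (Or33 _ _ erefl).
  case: mE mx my mz => -> mx my mz.
  + by split=> // xz; subst z; apply: nxy; apply: anti.
  + by case: nxy; apply: anti.
  + by case: nyz; apply: anti.
- move=> x y; have [|m mE mmin] := least (fun t => t = x \/ t = y).
    by exists x; left.
  have [->|nxy] := pselect (x = y); first by constructor 2.
  case: mE mmin => -> mmin; first by constructor 1; split=> //; apply: mmin; right.
  by constructor 3; split; [apply: mmin; left|move=> /esym].
Qed.

Lemma swo_exists (T : Type) : exists lt : T -> T -> Prop, strict_wo lt.
Proof.
have [R Rwo] := wochoice.well_ordering_principle {classic T}.
exact: (ex_intro _ _ (swo_well_order Rwo)).
Qed.

Definition lexico (A B : Type) (ltA : A -> A -> Prop) (ltB : B -> B -> Prop) (z w : A * B) :=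
  ltA z.1 w.1 \/ z.1 = w.1 /\ ltB z.2 w.2.

Lemma swo_lexico (A B : Type) (ltA : A -> A -> Prop) (ltB : B -> B -> Prop) :
  strict_wo ltA -> strict_wo ltB -> strict_wo (lexico ltA ltB).
Proof.
move=> woA woB; split.
- move=> [a b]; move: b.
  elim/(well_founded_ind (swo_wf woA)): a => a IHa b.
  elim/(well_founded_ind (swo_wf woB)): b => b IHb.
  by constructor=> -[a' b'] [/= /IHa//|/= [-> /IHb]].
- move=> [a b] [a' b'] [a'' b''] [/= h|[/= -> h]] [/= k|[/= <- k]].
  + by left; apply: swo_trans k.
  + by left.
  + by left.
  + by right; split=> //; apply: swo_trans k.
- move=> [a b] [a' b']; case: (swo_tot woA a a') => [h|->|h].
  + by constructor 1; left.
  + case: (swo_tot woB b b') => [h|->|h]; [constructor 1|constructor 2|constructor 3] => //;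
    by right.
  + by constructor 3; left.
Qed.

Lemma swo_nat : strict_wo (fun m n : nat => (m < n)%N).
Proof.
split.
- by move=> n; elim/ltn_ind: n => n IH; constructor=> m; apply: IH.
- by move=> y x z; apply: ltn_trans.
- by move=> x y; case: (ltngtP x y) => [h|h|->]; [constructor 1|constructor 3|constructor 2].
Qed.

(** * Comparability and squares of cardinals *)

Lemma embeds_total (A B : Type) : embeds A B \/ embeds B A.
Proof.
have [lt wo] := swo_exists A.
have [[b0]|nB] := pselect (inhabited B); last first.
  by right; exists (fun b => False_rect A (nB (inhabits b))) => b; case: nB; exists.
(* Either a fresh value is always available, and recursion injects A into B, or some [h] already
   covers B. *)
have [h|] := pselect (forall a (h : A -> B), exists b, forall a', lt a' a -> h a' <> b).
  have [|g gP] := wf_build b0 (swo_wf wo) _ h.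
    by move=> a h1 h2 b h12 H a' la; rewrite -h12 //; apply: H.
  left; exists g => x y gxy; case: (swo_tot wo x y) => // l.
    by case: (gP _ _ l).
  by case: (gP _ _ l).
move=> /existsNP[a /existsNP[h /forallNP H]]; right.
apply: (@embeds_surj _ _ h) => b; apply: contrapT => /forallNP hb.
by apply: (H b) => a' _; apply: hb.
Qed.

(* Choose recursively a value not yet taken: no initial segment exhausts B. *)
Lemma embeds_of_segments (A B : Type) (lt : A -> A -> Prop) : strict_wo lt ->
  (forall a, ~ embeds B {x | lt x a}) -> embeds A B.
Proof.
move=> wo seg.
have [[b0]|nB] := pselect (inhabited B); last first.
  exists (fun a => False_rect B (seg a (ex_intro _ (fun b => False_rect _ (nB (inhabits b)))
     (fun b => False_rect _ (nB (inhabits b)))))) => a.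
  by case: (seg a); exists (fun b => False_rect _ (nB (inhabits b))) => b; case: nB; exists.
have [||g gP] := @wf_build _ _ lt b0 (fun a h b => forall a', lt a' a -> h a' <> b) (swo_wf wo).
- by move=> a h1 h2 b h12 H a' la; rewrite -h12 //; apply: H.
- move=> a h; apply: contrapT => /forallNP no; apply: (seg a).
  apply: (@embeds_surj _ _ (fun x => h (sval x))) => b.
  have /existsNP[a' H] := no b.
  have [la hab] : lt a' a /\ h a' = b.
    by split; apply: contrapT => N; apply: H => // _; apply: N.
  by exists (exist _ a' la).
- exists g => x y gxy; case: (swo_tot wo x y) => // l.
    by case: (gP _ _ l).
  by case: (gP _ _ l).
Qed.

(** Hilbert's hotel: a shift along the copy of [nat] frees [u 0] for [None]. *)
Lemma embeds_option (T : Type) : embeds nat T -> embeds (option T) T.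
Proof.
move=> [u ui].
pose f x := if pselect (exists n, x = u n) is left h then u (projT1 (cid h)).+1 else x.
have fu n : f (u n) = u n.+1.
  rewrite /f; case: pselect => [h|[]]; last by exists n.
  by case: (cid h) => m /= /ui ->.
have fn x : (forall n, x <> u n) -> f x = x.
  by move=> h; rewrite /f; case: pselect => // k; exfalso; case: k => n /h.
exists (fun o => if o is Some x then f x else u 0%N).
have caseT x : (exists n, x = u n) \/ (forall n, x <> u n).
  have [h|/forallNP h] := pselect (exists n, x = u n); by [left|right].
move=> [x|] [y|] //.
- case: (caseT x) => [[n ->]|hx]; case: (caseT y) => [[m ->]|hy];
    rewrite ?fu ?(fn _ hx) ?(fn _ hy).
  + by move=> /ui[->].
  + by move=> /esym/hy.
  + by move=> /hx.
  + by move=> ->.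
- by case: (caseT x) => [[n ->]|hx]; [rewrite fu => /ui|rewrite fn // => /hx].
- by case: (caseT y) => [[n ->]|hx]; [rewrite fu => /ui|rewrite fn // => /esym/hx].
Qed.

Lemma nembeds_nat (T : Type) : ~ embeds nat T <-> finite_set [set: T].
Proof. by rewrite -card_leTP; split; rewrite finite_setPn. Qed.

Lemma finite_sq (T : Type) : ~ embeds nat T -> ~ embeds nat (T * T).
Proof. by rewrite !nembeds_nat -setXTT; move=> h; apply: finite_setX. Qed.

Lemma finite_option (T : Type) : ~ embeds nat T -> ~ embeds nat (option T).
Proof.
rewrite !nembeds_nat => h.
have -> : [set: option T] = [set None] `|` (some @` [set: T]).
  by apply/seteqP; split=> // -[x|] _; [right; exists x|left].
by rewrite finite_setU; split; [exact: finite_set1|exact: finite_image].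
Qed.

(* In Goedel's well-order of pairs (by maximum first), every initial segment lies in the
   square of a closed initial segment of T. *)
Lemma embeds_sq_step (T : Type) (lt : T -> T -> Prop) : strict_wo lt ->
  embeds nat T -> (forall x, ~ embeds T {y | lt y x}) ->
  (forall x, embeds nat {y | lt y x} ->
     embeds ({y | lt y x} * {y | lt y x}) {y | lt y x}) ->
  embeds (T * T) T.
Proof.
move=> wo inf init sq.
pose mx (z : T * T) := if pselect (lt z.1 z.2) then z.2 else z.1.
have mxP z : ~ lt (mx z) z.1 /\ ~ lt (mx z) z.2.
  by rewrite /mx; case: pselect => h; split=> //; [exact: swo_asym|exact: swo_irr|exact: swo_irr].
pose f (z : T * T) := (mx z, z).
have fi : injective f by move=> x y [].
have wo2 := swo_pull (swo_lexico wo (swo_lexico wo wo)) fi.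
apply: (embeds_of_segments wo2) => z Tz.
pose m := mx z; pose S := {y | lt y m}.
have le_opt : embeds {y | ~ lt m y} (option S).
  exists (fun y => if pselect (lt (sval y) m) is left h
    then Some (exist (fun x => lt x m) (sval y) h) else None).
  move=> [x hx] [y hy] /=; case: pselect => xm; case: pselect => ym //.
    by case=> xy; apply: eq_exist.
  move=> _; apply: eq_exist => /=.
  by case: (swo_tot wo x y) => [xy||yx] //; [have := swo_lt_le wo xy hy|have := swo_lt_le wo yx hx].
have Tsq : embeds T (option S * option S).
  apply: embeds_trans Tz (embeds_trans _ (embeds_prod le_opt le_opt)).
  have H (w : T * T) : lexico lt (lexico lt lt) (f w) (f z) -> ~ lt m w.1 /\ ~ lt m w.2.
    have [h1 h2] := mxP w.
    by case=> [/= l|[/= e _]]; rewrite /m -?e //; split=> k;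
       [apply: h1|apply: h2]; apply: swo_trans k.
  exists (fun w => (exist (fun x => ~ lt m x) (sval w).1 (H _ (proj2_sig w)).1,
                    exist (fun x => ~ lt m x) (sval w).2 (H _ (proj2_sig w)).2)).
  move=> [[a b] hx] [[a' b'] hy] /= [ea eb]; apply: eq_exist; by rewrite ea eb.
have [infS|finS] := pselect (embeds nat S).
  apply: (init m); apply: embeds_trans Tsq (embeds_trans _ (sq _ infS)).
  by apply: embeds_prod; apply: embeds_option.
by have /finite_sq := finite_option finS; apply; apply: embeds_trans Tsq.
Qed.

(** Induction over initial segments: one that embeds into a shorter one inherits the claim;
    otherwise it is an initial ordinal and [embeds_sq_step] applies. The same dichotomy settles T
    itself. *)
Lemma embeds_sq (T : Type) : embeds nat T -> embeds (T * T) T.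
Proof.
have [lt wo] := swo_exists T.
have seg x : embeds nat {y | lt y x} -> embeds ({y | lt y x} * {y | lt y x}) {y | lt y x}.
  elim/(well_founded_ind (swo_wf wo)): x => x IH inf.
  have [[y [yx xy]]|no] := pselect (exists y, lt y x /\ embeds {y | lt y x} {z | lt z y}).
    apply: embeds_trans (embeds_prod xy xy) (embeds_trans (IH y yx _) _).
      exact: embeds_trans xy.
    by apply: embeds_sig => z zy; apply: swo_trans yx.
  pose lt' (a b : {y | lt y x}) := lt (sval a) (sval b).
  have segE a : embeds {b | lt' b a} {z | lt z (sval a)}.
    by exists (fun b => exist (fun z => lt z (sval a)) (sval (sval b)) (proj2_sig b))
       => -[[b h1] h2] [[c h3] h4] /= [e];
       apply: eq_exist; apply: eq_exist.
  have segE' a : embeds {z | lt z (sval a)} {b | lt' b a}.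
    exists (fun b => exist (fun b => lt' b a) (exist (fun z => lt z x) (sval b)
      (swo_trans wo (proj2_sig b) (proj2_sig a))) (proj2_sig b)).
    by move=> [b h] [c k] /= [e]; apply: eq_exist.
  refine (@embeds_sq_step _ lt' _ inf _ _).
  - apply: (swo_pull wo) =>  -[a h] [b k] /= e; exact: eq_exist.
  - move=> a h; apply: no; exists (sval a); split; first exact: (proj2_sig a).
    exact: embeds_trans (segE a).
  - move=> a h; have := IH _ (proj2_sig a) (embeds_trans h (segE a)) => k.
    exact: embeds_trans (embeds_prod (segE a) (segE a)) (embeds_trans k (segE' a)).
move=> inf; have [[x Tx]|no] := pselect (exists x, embeds T {y | lt y x}).
  apply: embeds_trans (embeds_prod Tx Tx) (embeds_trans (seg x _) (@embeds_sval _ _)).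
  exact: embeds_trans Tx.
by apply: (embeds_sq_step wo) => // x h; apply: no; exists x.
Qed.

Lemma embeds_prodW (A B T : Type) : embeds nat T -> embeds A T -> embeds B T -> embeds (A * B) T.
Proof. by move=> inf AT BT; apply: embeds_trans (embeds_prod AT BT) (embeds_sq inf). Qed.

Lemma embeds_seq (T : Type) : embeds nat T -> embeds (seq T) T.
Proof.
move=> inf; have [j ji] := embeds_sq inf.
have [t0] : inhabited T by case: inf => u _; exists; exact: u 0%N.
(* Iterated pairing is shown injective among sequences of equal length, so the size is recorded as
   well. *)
pose code := foldr (fun x y => j (x, y)) t0.
have codeI s t : size s = size t -> code s = code t -> s = t.
  elim: s t => [|x s IH] [|y t] //= [st] /ji[-> /IH e]; by rewrite e.
apply: (@embeds_trans _ (nat * T)); last exact: embeds_prodW (embeds_refl T).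
by exists (fun s => (size s, code s)) => s t [/codeI].
Qed.

(** * Club guessing *)

Section RegularOrder.
Variables (L : Type) (lt : L -> L -> Prop).
Hypothesis wo : strict_wo lt.
Hypothesis reg : forall (A : Type) (g : A -> L), ~ embeds L A -> exists x, forall a, lt (g a) x.
Hypothesis segL : forall x, ~ embeds L {y | lt y x}.
Hypothesis L_uncountable : ~ embeds L nat.

Lemma above2 x y : exists z, lt x z /\ lt y z.
Proof.
have [|z zP] := @reg _ (fun b : bool => if b then x else y).
  by move=> h; apply/L_uncountable/(embeds_trans h); exists nat_of_bool => -[] [].
by exists z; split; [apply: (zP true)|apply: (zP false)].
Qed.

(* closed in the order topology, and containing the least element *)
Definition closed_in (E : set L) : Prop :=
  forall x, (forall y, lt y x -> exists e, [/\ E e, lt y e & ~ lt x e]) -> E x.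

(** The maximum of the points of [E] up to and including [a]. *)
Definition is_drop (E : set L) (a x : L) : Prop :=
  [/\ E x, ~ lt a x & forall e, E e -> ~ lt a e -> ~ lt x e].

Definition drop_to (E : set L) (a : L) : L := 
  if pselect (exists x, is_drop E a x) is left h then projT1 (cid h) else a.

Lemma is_drop_uniq E a x y : is_drop E a x -> is_drop E a y -> x = y.
Proof.
move=> [Ex ax xm] [Ey ay ym]; case: (swo_tot wo x y) => // h.
  by case: (xm _ Ey ay).
by case: (ym _ Ex ax).
Qed.

(** The supremum of the points of [E] up to [a] lies in [E] by closedness; an empty supremum is the
    least point, which closed sets contain. *)
Lemma drop_toP E a : closed_in E -> is_drop E a (drop_to E a).
Proof.
move=> Ecl; rewrite /drop_to; case: pselect => [h|none]; first by case: (cid h).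
exfalso; apply: none.
have [|x xP xmin] := swo_least wo (P := fun x => forall e, E e -> ~ lt a e -> ~ lt x e).
  by exists a => e _.
have ax : ~ lt a x by move=> h; apply: (xmin a _ h) => e _.
exists x; split=> //; apply: Ecl => y yx.
have /existsNP[e] : ~ forall e, E e -> ~ lt a e -> ~ lt y e by move=> /xmin; apply.
move=> /not_implyP[Ee] /not_implyP[ae] /contrapT ye.
by exists e; split=> //; apply: xP.
Qed.

Lemma drop_to_eq E a x : closed_in E -> is_drop E a x -> drop_to E a = x.
Proof. by move=> /drop_toP h; apply: is_drop_uniq. Qed.

(** Clubs are represented in this form: every club contains such a set, with [f] sending a point to
    the next point of the club. *)
Definition closure_points (f : L -> L) : set L :=
  [set x | forall y, lt y x -> lt (f y) x].

Lemma closure_points_closed f : closed_in (closure_points f).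
Proof.
move=> x h y yx; have [e [Ee ye xe]] := h y yx.
by apply: (swo_lt_le wo) xe; apply: Ee.
Qed.

(** [nx y] exceeds [y] and all [f t] with t at most [y]. The supremum of the iterates of [nx] from
    [x] exists because countable sets are bounded, and it is a closure point. *)
Lemma closure_points_unbounded f x : exists2 y, closure_points f y & lt x y.
Proof.
have /choice[nx nxP] : forall y, exists z, lt y z /\ forall t, ~ lt y t -> lt (f t) z.
  move=> y; have [z1 z1P] := @reg _ (fun t : {t | lt t y} => f (sval t)) (@segL y).
  have [z2 [yz2 fz2]] := above2 y (f y); have [z [z1z z2z]] := above2 z1 z2.
  exists z; split=> [|t /(swo_nlt wo)[->|ty]]; first exact: (swo_trans wo) z2z.
    exact: (swo_trans wo) z2z.
  by apply: (swo_trans wo) z1z; apply: (z1P (exist _ t ty)).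
pose s n := iter n nx x.
have [y yP ymin] := swo_least wo (@reg _ s L_uncountable).
exists y; last exact: (yP 0%N).
move=> z zy; have /existsNP[n sn] : ~ forall n, lt (s n) z by move=> /ymin.
by apply: (swo_trans wo) (yP n.+1); have [_] := nxP (s n); apply.
Qed.

Lemma closure_points_anti f f' : (forall x, ~ lt (f' x) (f x)) ->
  closure_points f' `<=` closure_points f.
Proof. by move=> ff' x h y /h; apply: (swo_le_lt wo). Qed.

End RegularOrder.

(** * The guessing principle, by iterating failures along M *)

Section ClubGuessing.
Variables (L M mu : Type) (lt : L -> L -> Prop) (ltM : M -> M -> Prop) (ltm : mu -> mu -> Prop).
Hypotheses (wo : strict_wo lt) (woM : strict_wo ltM) (wom : strict_wo ltm).
Hypothesis reg : forall (A : Type) (g : A -> L), ~ embeds L A -> exists x, forall a, lt (g a) x.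
Hypothesis segL : forall x, ~ embeds L {y | lt y x}.
Hypothesis mu_inf : embeds nat mu.
Hypothesis segM : forall a, embeds {b | ltM b a} mu.
Hypothesis M_gt_mu : ~ embeds M mu.
Hypothesis mu_le_M : embeds mu M.
Hypothesis M_lt_L : ~ embeds L M.

(** M behaves as mu^+, which is regular: an unbounded family would cover M by at most |mu| closed
    segments of at most |mu| points each. *)
Lemma bounded_M (A : Type) (g : A -> M) : embeds A mu -> exists x, forall a, ltM (g a) x.
Proof.
move=> Amu; apply: contrapT => /forallNP unb.
have /choice[k kP] : forall x, exists a, ~ ltM (g a) x by move=> x; apply/existsNP/unb.
pose code a := projT1 (cid (segM a)).
have codeI a : injective (code a) by rewrite /code; case: cid.
apply: M_gt_mu; apply: (@embeds_trans _ (A * option mu)); last first.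
  apply: embeds_prodW => //; exact: embeds_option.
exists (fun x => (k x, if pselect (ltM x (g (k x))) is left h
  then Some (code _ (exist (fun y => ltM y (g (k x))) x h)) else None)) => x y [kxy].
have := kP x; have := kP y; rewrite -kxy.
case: pselect => hx; case: pselect => hy // py px.
  by move=> [] /codeI[].
move=> _; have /(swo_nlt woM) [->|//] := px.
by have /(swo_nlt woM) [->|//] := py.
Qed.

Lemma natmu_le_mu : embeds (nat * mu) mu.
Proof. by apply: embeds_prodW => //; apply: embeds_refl. Qed.

Lemma not_L_le_natmu : ~ embeds L (nat * mu).
Proof.
move=> h; apply: M_lt_L; apply: embeds_trans h _.
exact: embeds_trans natmu_le_mu mu_le_M.
Qed.

Lemma not_L_le_nat : ~ embeds L nat.
Proof.
by move=> h; apply: M_lt_L; apply: embeds_trans h (embeds_trans mu_inf mu_le_M).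
Qed.

Definition block_increasing (c : nat * mu -> L) : Prop :=
  forall z w, lexico (fun m n : nat => (m < n)%N) ltm z w -> lt (c z) (c w).

Let wonm := swo_lexico swo_nat wom.

Lemma block_increasing_ex : inhabited L -> exists c, block_increasing c.
Proof.
move=> [l0].
have [||c cP] := wf_build (B := L)
  (P := fun z c y => forall z', lexico (fun m n : nat => (m < n)%N) ltm z' z -> lt (c z') y)
  l0 (swo_wf wonm).
- by move=> z c c' y cc' h z' lz; rewrite -cc' //; apply: h.
- by move=> z c; have [y yP] := @reg _ c not_L_le_natmu; exists y => z' _.
- by exists c => z w; apply: cP.
Qed.

(** A ladder of length M is fixed below each point d that admits one. The index (d, j) stands for a
    selection from this ladder at positions below j, every point being dropped to a fixed club; the
    argument finds a club for which these families guess. *)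
Theorem club_guessing : exists c : L * M -> nat * mu -> L,
  (forall i, block_increasing (c i)) /\
  forall f : L -> L, exists i, forall z, closure_points lt f (c i z).
Proof.
have [m0] : inhabited mu by case: mu_inf => u _; exists; apply: u 0%N.
have [a0] : inhabited M by case: mu_le_M => u _; exists; apply: u m0.
have [l0] : inhabited L by apply: contrapT => nL; apply: not_L_le_nat;
  exists (fun x => False_rect _ (nL (inhabits x))) => x; case: nL; exists.
have [c0 c0P] := block_increasing_ex (inhabits l0).
(* The ladder [u] need not be increasing: the selections [b] restore monotonicity. *)
pose cofin d (u : M -> L) := (forall x, lt (u x) d) /\
  forall y, lt y d -> exists x, ~ lt (u x) y.
have /choice[C CP] : forall d, exists u, (exists u', cofin d u') -> cofin d u.
  move=> d; have [[u uP]|no] := pselect (exists u', cofin d u').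
    by exists u.
  by exists (fun _ => l0) => /no.
pose good E i (b : nat * mu -> M) := (forall z, ltM (b z) i.2) /\
  block_increasing (fun z => drop_to lt E (C i.1 (b z))).
have /choice[cfam cfamP] : forall Ei : set L * (L * M), exists c, block_increasing c /\
    ((exists b, good Ei.1 Ei.2 b) ->
     exists2 b, good Ei.1 Ei.2 b & c = fun z => drop_to lt Ei.1 (C Ei.2.1 (b z))).
  move=> [E i]; have [[b bP]|no] := pselect (exists b, good E i b).
    by exists (fun z => drop_to lt E (C i.1 (b z))); split; [case: bP|exists b].
  by exists c0; split=> // /no.
(* If no family [cfam (closure_points f)] guesses, iterate the counterexamples through M and let
   [E a] be the decreasing clubs obtained. The largest element of [E a] below a given point
   decreases with a, so it is eventually constant; for fewer than |M| points this happens at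
   a common stage [i], after which the family of stage [i] lies in all the later clubs. *)
apply: contrapT => noguess.
have /choice[next nextP] : forall f : L -> L, exists f' : L -> L,
    forall i, exists z, ~ closure_points lt f' (cfam (closure_points lt f, i) z).
  move=> f; apply: contrapT => no; apply: noguess.
  exists (fun i => cfam (closure_points lt f, i)); split=> [i|f'].
    by case: (cfamP (closure_points lt f, i)).
  apply: contrapT => /forallNP no'; apply: no; exists f' => i.
  exact/existsNP/no'.
have boundM (g : M -> L) : exists x, forall a, lt (g a) x by apply: reg.
have bound (h : M -> L -> L) : exists f : L -> L, forall a x,
    ~ lt (f x) (h a x) /\ ~ lt (f x) (next (h a) x).
  have /choice[f fP] : forall x, exists y, forall a,
      ~ lt y (h a x) /\ ~ lt y (next (h a) x).
    move=> x; have [y1 y1P] := boundM (fun a => h a x).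
    have [y2 y2P] := boundM (fun a => next (h a) x).
    have [y [y1y y2y]] := above2 reg not_L_le_nat y1 y2.
    exists y => a; split; apply: (swo_asym wo).
      by apply: (swo_trans wo) y1y.
    by apply: (swo_trans wo) y2y.
  by exists f => a x; apply: fP.
have [||F FP] := wf_build (B := L -> L)
    (P := fun a h f => forall a', ltM a' a ->
       forall x, ~ lt (f x) (h a' x) /\ ~ lt (f x) (next (h a') x))
    id (swo_wf woM).
- by move=> a h h' f hh' H a' la x; rewrite -hh' //; apply: H.
- by move=> a h; have [f fP] := bound h; exists f => a' _ x.
pose E a := closure_points lt (F a).
have Emono a a' : ~ ltM a' a -> E a' `<=` E a.
  move=> /(swo_nlt woM)[->//|aa']; apply: (closure_points_anti wo) => x.
  by case: (FP a' a aa' x).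
have Ecl a : closed_in lt (E a) by apply: (closure_points_closed wo).
pose Einf x := forall a, E a x.
have Einfcl : closed_in lt Einf.
  move=> x h a; apply: (Ecl a) => y /h[e [Ee ye xe]]; exists e; split=> //; exact: Ee.
have Einfunb x : exists2 y, Einf y & lt x y.
  have [f fP] := bound F; have [y fy xy] := closure_points_unbounded wo reg segL not_L_le_nat f x.
  exists y => // a; apply: (closure_points_anti wo) fy => t.
  by case: (fP a t).
have [||e eP] := wf_build (B := L)
    (P := fun a h y => Einf y /\ forall a', ltM a' a -> lt (h a') y)
    l0 (swo_wf woM).
- by move=> a h h' f hh' [H1 H2]; split=> // a' la; rewrite -hh' //; apply: H2.
- move=> a h; have [x xP] := boundM h; have [y Ey xy] := Einfunb x.
  by exists y; split=> // a' _; apply: (swo_trans wo) xy.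
(* [d] is the supremum of an M-sequence lying in all the clubs, so it has a ladder [C d], possibly
   different from [e] but also cofinal in [d]. *)
have [d dP dmin] := swo_least wo (boundM e).
have Mabove a : exists a', ltM a a'.
  by have [a' h] := bounded_M (fun _ : mu => a) (embeds_refl mu); exists a'; apply: h m0.
have ebelow y : lt y d -> exists a, lt y (e a).
  move=> yd; have /existsNP[a ya] : ~ forall a, lt (e a) y by move=> /dmin.
  have [a' aa'] := Mabove a; exists a'; apply: (swo_le_lt wo ya).
  by case: (eP a') => _; apply.
have [Cd Ccof] : cofin d (C d).
  apply: CP; exists e; split=> // y /ebelow[a ya]; exists a; exact: (swo_asym wo).
pose h x := drop_to lt Einf (C d x).
have hP x : is_drop lt Einf (C d x) (h x) by apply: (drop_toP wo).
have h_above a : exists x, ~ lt (h x) (e a).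
  have [x xP] := Ccof _ (dP a); exists x.
  by have [_ _] := hP x; apply=> //; case: (eP a).
have h_below x : exists a, lt (h x) (e a).
  by apply: ebelow; apply: (swo_le_lt wo) (Cd x); case: (hP x).
have /choice[hb hbP] := h_below.
(* The drops [h x] are cofinal in [d], and at most |mu| values precede each choice, so positions
   with increasing drops can be chosen recursively. *)
have [||b bP] := wf_build (B := M)
    (P := fun z g y => forall z', lexico (fun m n : nat => (m < n)%N) ltm z' z ->
        lt (h (g z')) (h y)) a0 (swo_wf wonm).
- by move=> z c c' y cc' H z' lz; rewrite -cc' //; apply: H.
- move=> z g; have [a aP] := bounded_M (fun z' => hb (g z')) natmu_le_mu.
  have [y yP] := h_above a; exists y => z' _.
  apply: (swo_lt_le wo) yP; apply: (swo_trans wo) (hbP _) _.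
  by case: (eP a) => _; apply.
have [j bj] := bounded_M b natmu_le_mu.
pose dr a x := drop_to lt (E a) (C d x).
have drP a x : is_drop lt (E a) (C d x) (dr a x) by apply: (drop_toP wo).
have /choice[st stP] : forall x, exists a, forall a', ~ ltM a' a -> dr a' x = dr a x.
  move=> x; have [|y [a ya] ymin] := swo_least wo (P := fun y => exists a, y = dr a x).
    by exists (dr a0 x), a0.
  exists a => a' aa'; case: (swo_tot wo (dr a' x) (dr a x)) => // [|] l.
    by case: (ymin (dr a' x)); [exists a'|rewrite ya].
  have [_ _ am] := drP a x; have [Ea' ca' _] := drP a' x.
  by case: (am (dr a' x)) => //; apply: Emono Ea'.
have [i iP] := bounded_M (fun x : {x | ltM x j} => st (sval x)) (segM j).
have hE x : ltM x j -> dr i x = h x.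
  move=> xj; have stab a : ~ ltM a i -> dr a x = dr i x.
    have si := iP (exist _ x xj); move=> ai.
    rewrite !(stP x) //; first exact: (swo_asym woM).
    by move=> l; apply: ai; apply: (swo_trans woM) si.
  apply/esym/(drop_to_eq wo) => //; have [Ei Ci im] := drP i x; split=> // [a|y Ey]; last first.
    by apply: im; apply: Ey.
  case: (swo_tot woM a i) => [ai|->//|ia].
    by apply: Emono Ei; apply: (swo_asym woM).
  by rewrite -(stab a); [case: (drP a x)|apply: (swo_asym woM)].
(* [b] shows that a selection exists at stage [i]. The one made by [cfam] may be another [b'], but
   its positions are also below [j], where the drops to [E i] lie in all the clubs. *)
have [_ [|b' [b'j _] cE]] := cfamP (E i, (d, j)).
  exists b; split=> //= z w /bP; rewrite -!/(dr i _) !hE //.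
have [z] := nextP (F i) (d, j); rewrite -/(E i) cE /= -/(dr i _) hE; last exact: b'j.
have [i' ii'] := Mabove i; apply.
have : E i' (h (b' z)) by case: (hP (b' z)).
by apply: (closure_points_anti wo) => x; case: (FP i' i ii' x).
Qed.

End ClubGuessing.

(** * Reduced torsion-free modules over Z_(p) *)

Local Open Scope ring_scope.

Section SubgroupType.
Variables (V : zmodType) (P : {pred V}).

(** The proof [clP] is an argument so that the closedness instance can be attached to the
    predicate. *)
Definition subgroup_of (clP : zmod_closed P) : {pred V} := P.

Variable clP : zmod_closed P.
HB.instance Definition _ := GRing.isZmodClosed.Build V (subgroup_of clP) clP.

Definition subgroup_type : Type := {v : V | v \in subgroup_of clP}.
HB.instance Definition _ := SubChoice.on subgroup_type.
HB.instance Definition _ := [SubChoice_isSubZmodule of subgroup_type by <:].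

End SubgroupType.

Lemma pair_mulrn (H K : zmodType) (z : H * K) n : z *+ n = (z.1 *+ n, z.2 *+ n).
Proof. by elim: n => [|n IH]; rewrite ?mulr0n // !mulrS IH. Qed.

Section Pmodules.
Variable p : nat.
Hypothesis p_prime : prime p.

Let p_gt0 : (0 < p)%N := prime_gt0 p_prime.

Lemma expp_neq0 k : (p ^ k)%:R != 0 :> rat.
Proof. by rewrite pnatr_eq0 -lt0n expn_gt0 p_gt0. Qed.

(* A module over Z_(p) is encoded as a group divisible by all integers prime to p. *)
Definition reduced_module (H : zmodType) : Prop :=
  [/\ torsion_free H,
      forall d, ~~ (p %| d)%N -> forall g : H, exists g', g = g' *+ d &
      forall g : H, (forall k, exists g', g = g' *+ p ^ k) -> g = 0].

(** * Characteristics and the p-type *)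

Lemma char_equiv_sym chi chi' : char_equiv chi chi' -> char_equiv chi' chi.
Proof.
have E : [set q | chi q <> chi' q] = [set q | chi' q <> chi q].
  by apply/seteqP; split=> q /= h e; apply: h.
move=> [fin fq]; split; first by rewrite -E.
by move=> q h; have [] := fq q (fun e => h (esym e)).
Qed.

Lemma char_equiv_trans chi chi' chi'' :
  char_equiv chi chi' -> char_equiv chi' chi'' -> char_equiv chi chi''.
Proof.
move=> [fin1 f1] [fin2 f2]; split.
  apply: (@sub_finite_set _ _ ([set q | chi q <> chi' q] `|` [set q | chi' q <> chi'' q])).
    move=> q /= h; have [e|] := pselect (chi q = chi' q); last by left.
    by right; rewrite -e.
  by rewrite finite_setU.
move=> q h; have [e|ne] := pselect (chi q = chi' q).
  by have := f2 q; rewrite -e; apply.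
have [h1 h2] := f1 q ne; split=> // h3.
have [e|ne'] := pselect (chi' q = chi'' q); first by apply: h2; rewrite e.
by have [_] := f2 q ne'; apply.
Qed.

Lemma type_class_eq chi chi' : char_equiv chi chi' -> type_class chi = type_class chi'.
Proof.
move=> h; apply/seteqP; split=> c; apply: char_equiv_trans => //.
exact: char_equiv_sym.
Qed.

Lemma height_eq (H : zmodType) q (g : H) h : is_height q g h -> height q g = h.
Proof.
move=> gh; rewrite /height; case: xgetP => [h' _ gh'|/(_ h) //].
case: h h' gh gh' => [k|] [k'|] //=.
- move=> [gk kmax] [gk' kmax']; congr Some; apply/eqP; rewrite eqn_leq.
  by rewrite kmax // kmax'.
- by move=> [_ kmax] /(_ k.+1)/kmax; rewrite ltnn.
- by move=> all [_ /(_ k'.+1 (all _))]; rewrite ltnn.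
Qed.

(** Divisibility by primes other than p gives height oo there; reducedness makes the p-height of a
    nonzero element finite. So its characteristic differs from the standard one at most at p. *)
Lemma reduced_module_tf_homogeneous (H : zmodType) :
  reduced_module H -> tf_homogeneous (p_type p) H.
Proof.
move=> [tf divH redH]; split=> // g g0.
apply: type_class_eq.
pose chi := characteristic_of g.
have chiq (q : prime_number) : val q != p -> chi q = None.
  move=> qp; apply: height_eq => /= j.
  have [|g' ->] := divH (val q ^ j)%N _ g; last by exists g'.
  rewrite Euclid_dvdX // negb_and dvdn_prime2 //; first by rewrite eq_sym qp.
  exact: valP q.
have chip (q : prime_number) : val q = p -> chi q <> None.
  move=> qp; have [k kmin] : exists k, ~ exists g', g = g' *+ p ^ k.
    by apply/existsNP => /redH.
  have nk j : (k <= j)%N -> ~ multiples (p ^ j) [set: H] g.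
    move=> kj [g' _ g'g]; apply: kmin; exists (g' *+ p ^ (j - k)).
    by rewrite -mulrnA -expnD subnK.
  have ex0 : exists j, `[< multiples (p ^ j) [set: H] g >].
    by exists 0%N; apply/asboolP; exists g; rewrite ?expn0 ?mulr1n.
  have ub j : `[< multiples (p ^ j) [set: H] g >] -> (j <= k)%N.
    by move=> /asboolP gj; rewrite leqNgt; apply/negP => /ltnW /nk.
  have [m /asboolP gm mmax] := ex_maxnP ex0 ub.
  rewrite /chi /characteristic_of qp (_ : height p g = Some m) //.
  by apply: height_eq; split=> // j /asboolP/mmax.
rewrite -/chi; split.
  apply: (@sub_finite_set _ _ [set (exist _ p p_prime : prime_number)]); last exact: finite_set1.
  move=> q /=; case: eqP => [qp _|/eqP/chiq -> //].
  exact: val_inj.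
move=> q; case: eqP => [qp _|/eqP/chiq -> //].
by split=> //; apply: chip.
Qed.

Lemma reduced_module_prod (H K : zmodType) :
  reduced_module H -> reduced_module K -> reduced_module (H * K)%type.
Proof.
move=> [tfH divH redH] [tfK divK redK].
split.
- move=> n [a b] n0; rewrite pair_mulrn => -[/= /tfH -> // /tfK -> //].
- move=> d pd [a b]; have [a' ->] := divH d pd a; have [b' ->] := divK d pd b.
  by exists (a', b'); rewrite pair_mulrn.
- move=> [a b] h; congr (_, _).
    by apply: redH => k; have [[a' b']] := h k; rewrite pair_mulrn => -[-> _]; exists a'.
  by apply: redK => k; have [[a' b']] := h k; rewrite pair_mulrn => -[_ ->]; exists b'.
Qed.

Lemma reduced_submodule (V : lmodType rat) (P : {pred V}) (clP : zmod_closed P) :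
  (forall d v, ~~ (p %| d)%N -> v \in P -> d%:R^-1 *: v \in P) ->
  (forall v, (forall k, (p ^ k)%:R^-1 *: v \in P) -> v = 0) ->
  reduced_module (subgroup_type clP).
Proof.
move=> divP redP.
have valMn (g : subgroup_type clP) n : val (g *+ n) = n%:R *: val g.
  by rewrite raddfMn scaler_nat.
split.
- move=> n g n0 /(congr1 val); rewrite valMn raddf0 => /eqP.
  rewrite scaler_eq0 pnatr_eq0 -leqn0 leqNgt n0 /= => /eqP g0.
  by apply: val_inj; rewrite raddf0.
- move=> d pd g; exists (Sub (d%:R^-1 *: val g) (divP _ _ pd (valP g))).
  apply: val_inj; rewrite valMn SubK scalerA divff ?scale1r //.
  by rewrite pnatr_eq0; apply: contra pd => /eqP ->.
- move=> g h; apply: val_inj; rewrite raddf0; apply: redP => k.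
  have [g' ->] := h k; rewrite valMn scalerA mulVf ?expp_neq0 // scale1r.
  exact: valP g'.
Qed.

(** * Divisibility in the localization Z_(p) *)

(* r lies in p^n Z_(p) *)
Definition dv (n : nat) (r : rat) : Prop :=
  exists (a : int) (d : nat), ~~ (p %| d)%N /\ r * d%:R = (p ^ n)%:R * a%:~R.

Let dneq0 d : ~~ (p %| d)%N -> d%:R != 0 :> rat.
Proof. by move=> pd; rewrite pnatr_eq0; apply: contra pd => /eqP ->. Qed.

Lemma dv_sub n r r' : dv n r -> dv n r' -> dv n (r - r').
Proof.
move=> [a [d [pd E]]] [a' [d' [pd' E']]].
exists (a * d'%:Z - a' * d%:Z), (d * d')%N; split.
  by rewrite Euclid_dvdM // negb_or pd.
have -> : (r - r') * (d * d')%:R = r * d%:R * d'%:R - r' * d'%:R * d%:R.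
  by rewrite natrM; ring.
by rewrite E E' rmorphB !rmorphM /=; ring.
Qed.

Lemma dv_exp n k : (n <= k)%N -> dv n (p ^ k)%:R.
Proof.
move=> nk; exists (p ^ (k - n))%N, 1%N; rewrite dvdn1 neq_ltn prime_gt1 // orbT.
by rewrite mulr1 -[k in LHS](subnKC nk) expnD natrM.
Qed.

Lemma dv0 n : dv n 0.
Proof. by have := dv_sub (dv_exp (leqnn n)) (dv_exp (leqnn n)); rewrite subrr. Qed.

Lemma dv_div n d r : ~~ (p %| d)%N -> dv n r -> dv n (d%:R^-1 * r).
Proof.
move=> pd [a [d' [pd' E]]]; exists a, (d * d')%N; split.
  by rewrite Euclid_dvdM // negb_or pd.
by rewrite natrM mulrACA mulVf ?dneq0 // mul1r.
Qed.

Lemma dv_shift n k r : dv n ((p ^ k)%:R^-1 * r) <-> dv (n + k) r.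
Proof.
have pk := expp_neq0 k; split=> -[a [d [pd E]]]; exists a, d; split=> //.
  have {1}-> : r = (p ^ k)%:R * ((p ^ k)%:R^-1 * r) by rewrite mulVKf.
  by rewrite -mulrA E expnD natrM; ring.
by rewrite -mulrA E expnD natrM (mulrC (p ^ n)%:R) !mulrA mulVf // mul1r.
Qed.

(** If n is the absolute value of the numerator of [r], then [dv n r] makes p^n divide n, and n <
    p^n forces n = 0. *)
Lemma dv_eq0 r : (forall n, dv n r) -> r = 0.
Proof.
move=> h; have [a [d [pd E]]] := h `|numq r|%N.
set n := `|numq r|%N in E.
have E' : numq r * d%:Z = (p ^ n)%:Z * a * denq r.
  apply: (@intr_inj rat); rewrite !rmorphM /= numqE -!pmulrn.
  have -> : r * (denq r)%:~R * d%:R = r * d%:R * (denq r)%:~R by ring.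
  by rewrite E.
have : (p ^ n %| n * d)%N.
  rewrite (_ : n * d = p ^ n * (`|a| * `|denq r|))%N ?dvdn_mulr //.
  have := congr1 absz E'; rewrite !abszM /= => ->.
  by rewrite mulnA.
rewrite Gauss_dvdl; last by rewrite coprimeXl // prime_coprime.
have : (n < p ^ n)%N by apply: ltn_expl; apply: prime_gt1.
case: (posnP n) => [n0 _ _|n0 nlt /(dvdn_leq n0)]; last by rewrite leqNgt nlt.
by apply/eqP; rewrite -numq_eq0 -absz_eq0; apply/eqP.
Qed.

Lemma dv_exp_leq n k : dv n (p ^ k)%:R -> (n <= k)%N.
Proof.
move=> [a [d [pd E]]]; rewrite leqNgt; apply/negP => kn.
have : (p ^ k)%:Z * d%:Z = (p ^ n)%:Z * a.
  by apply: (@intr_inj rat); rewrite !rmorphM /= -!pmulrn.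
move=> /(congr1 absz); rewrite !abszM /= -(subnKC kn) addSnnS expnD -mulnA.
move=> /eqP; rewrite eqn_pmul2l ?expn_gt0 ?p_gt0 // => /eqP dE.
by move: pd; rewrite dE expnS -mulnA dvdn_mulr.
Qed.

Lemma dv_natmul n k r : dv n r -> dv (n + k) (r * (p ^ k)%:R).
Proof.
by move=> h; apply/dv_shift; rewrite mulrCA mulVf ?expp_neq0 // mulr1.
Qed.

(** * Pure closures in a power of Z_(p) *)

Section Lattice.
Variables (L Z : Type) (gen : Z -> L -> rat).

Definition in_span (h : L -> rat) : Prop :=
  exists s : seq (rat * Z), forall x, h x = \sum_(t <- s) t.1 * gen t.2 x.

(** For generators with values in Z_(p), this is their pure closure in the product of L copies of
    Z_(p). [rat^o] makes the functions a rational vector space. *)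
Definition lattice_pred : {pred L -> rat^o} :=
  [pred h : L -> rat^o | `[< in_span h /\ forall x, dv 0 (h x) >]].

Lemma in_span_scale (c : rat) (h : L -> rat) : in_span h -> in_span (fun x => c * h x).
Proof.
move=> [s sP]; exists [seq (c * t.1, t.2) | t <- s] => x.
by rewrite big_map sP mulr_sumr; apply: eq_bigr => t _; rewrite mulrA.
Qed.

Lemma in_span_sub (h h' : L -> rat) :
  in_span h -> in_span h' -> in_span (fun x => h x - h' x).
Proof.
move=> [s sP] /(in_span_scale (-1))[s' sP']; exists (s ++ s') => x.
by rewrite big_cat /= -sP -sP' mulN1r.
Qed.

Lemma in_span_gen z : in_span (gen z).
Proof. by exists [:: (1, z)] => x; rewrite big_seq1 mul1r. Qed.

Lemma lattice_closed : zmod_closed lattice_pred.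
Proof.
split.
  apply/asboolP; split=> [|x]; last exact: dv0.
  by exists [::] => x; rewrite big_nil.
move=> h h' /asboolP[hs hd] /asboolP[hs' hd']; apply/asboolP; split.
  exact: in_span_sub.
by move=> x; apply: dv_sub.
Qed.

Definition lattice : zmodType := subgroup_type lattice_closed.

Definition lat_val (h : lattice) : L -> rat := val h.

Lemma lat_val_inj : injective lat_val.
Proof. by move=> h h' /val_inj. Qed.

Lemma lat_span h : in_span (lat_val h).
Proof. by have /asboolP[] := valP h. Qed.

Lemma lat_dv h x : dv 0 (lat_val h x).
Proof. by have /asboolP[_] := valP h; apply. Qed.

Lemma lat_mk (h : L -> rat) : in_span h -> (forall x, dv 0 (h x)) ->
  exists h' : lattice, lat_val h' = h.
Proof.
move=> hs hd; have hP : (h : L -> rat^o) \in lattice_pred by apply/asboolP.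
by exists (Sub (h : L -> rat^o) hP); rewrite /lat_val SubK.
Qed.

Lemma lat_valB h h' x : lat_val (h - h') x = lat_val h x - lat_val h' x.
Proof. by rewrite /lat_val raddfB. Qed.

Lemma lat_valMn h n x : lat_val (h *+ n) x = lat_val h x * n%:R.
Proof.
rewrite mulr_natr; elim: n => [|n IH]; first by rewrite /lat_val raddf0.
by rewrite !mulrSr -IH /lat_val raddfD.
Qed.

Lemma lat_val_sum n (F : 'I_n -> lattice) x :
  lat_val (\sum_i F i) x = \sum_i lat_val (F i) x.
Proof.
apply: (big_morph (fun h => lat_val h x)) => [h h'|]; last by rewrite /lat_val raddf0.
by rewrite /lat_val raddfD.
Qed.

(** The rational span is closed under division, so divisibility by p^n can be tested at each
    coordinate. *)
Lemma lat_divide h n : (forall x, dv n (lat_val h x)) -> exists h', h = h' *+ p ^ n.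
Proof.
move=> hd; have [x|h' h'E] := lat_mk (in_span_scale (p ^ n)%:R^-1 (lat_span h)).
  by apply/dv_shift; apply: hd.
exists h'; apply: lat_val_inj; apply/funext => x.
by rewrite lat_valMn h'E mulrAC mulVf ?expp_neq0 // mul1r.
Qed.

Lemma lattice_reduced : reduced_module lattice.
Proof.
apply: reduced_submodule.
- move=> d v pd /asboolP[vs vd]; apply/asboolP; split.
    exact: (in_span_scale d%:R^-1 vs).
  by move=> x; apply: (dv_div pd (vd x)).
- move=> v h; apply/funext => x; apply: dv_eq0 => n.
  have /asboolP[_ /(_ x)] := h n.
  by rewrite -[n in X in _ -> X]add0n -dv_shift.
Qed.

Lemma embeds_lattice (T : Type) : embeds nat T -> embeds Z T -> embeds lattice T.
Proof.
move=> inf ZT; apply: (@embeds_trans _ (seq (rat * Z))).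
  pose code h := projT1 (cid (lat_span h)).
  exists code => h h'; rewrite /code; case: cid => s /= sP; case: cid => s' /= sP' ss'.
  by apply: lat_val_inj; apply/funext => x; rewrite sP sP' ss'.
apply: (@embeds_trans _ (seq T)); last exact: embeds_seq.
have [f fi] : embeds (rat * Z) T.
  apply: embeds_prodW => //; apply: embeds_trans inf.
  by exists pickle; apply: pcan_inj pickleK.
by exists (map f); apply: inj_map.
Qed.

End Lattice.

End Pmodules.

(** * The case of an infinite base *)

Definition pure_embedding (H G : zmodType) (h : {additive H -> G}) : Prop :=
  injective h /\ forall m z w, h z = w *+ m -> exists z', z = z' *+ m.

Lemma pure_subgroup_embedding (H G : zmodType) :
  isomorphic_to_pure_subgroup H G -> exists h : {additive H -> G}, pure_embedding h.
Proof.
move=> [A [[_ pureA] [h [hA hinj hsurj]]]]; exists h.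
have hi : injective h by move=> x y; apply: hinj; rewrite inE.
split=> // m z w zw.
have : multiples m A (h z).
  by rewrite pureA; split; [exists w|apply: hA].
move=> [a Aa az]; have [z' _ z'a] := hsurj a Aa.
by exists z'; apply: hi; rewrite raddfMn z'a az.
Qed.

Lemma embeds_sum (A B T : Type) : embeds nat T -> embeds A T -> embeds B T -> embeds (A + B) T.
Proof.
move=> inf [f fi] [g gi]; apply: (@embeds_trans _ (nat * T)).
  exists (fun z => match z with inl a => (0%N, f a) | inr b => (1%N, g b) end).
  by move=> [a|b] [a'|b'] //= [] => [/fi ->|/gi ->].
by apply: embeds_prodW => //; apply: embeds_refl.
Qed.

(** Counting: if every [s] were realized, a choice of realizers would inject S into W. *)
Lemma unrealized (S W T : Type) (R : W -> S -> Prop) :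
  (forall w s s', R w s -> R w s' -> s = s') -> embeds W T -> ~ embeds S T ->
  exists s, forall w, ~ R w s.
Proof.
move=> Rfun WT nST; apply: contrapT => /forallNP all; apply: nST.
have /choice[w wP] : forall s, exists w, R w s.
  by move=> s; apply: contrapT => /forallNP; apply: all.
apply: embeds_trans WT; exists w => s s' ss'.
by apply: (Rfun (w s)); rewrite // ss'.
Qed.

(** * A module that codes unrealized sequences *)

Section UncountableBase.
Variables (p : nat) (p_prime : prime p).
Variables (L I mu : Type) (lt : L -> L -> Prop) (ltm : mu -> mu -> Prop).
Hypotheses (wo : strict_wo lt) (wom : strict_wo ltm).
Hypothesis reg : forall (A : Type) (g : A -> L), ~ embeds L A -> exists x, forall a, lt (g a) x.
Hypothesis segL : forall x, ~ embeds L {y | lt y x}.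
Hypothesis L_inf : embeds nat L.
Hypothesis L_uncountable : ~ embeds L nat.
Variable c : I -> nat * mu -> L.
Hypothesis c_incr : forall i, block_increasing lt ltm (c i).
Hypothesis c_guess : forall f : L -> L, exists i, forall z, closure_points lt f (c i z).
Hypothesis L_lt_power : ~ embeds (nat -> mu) L.

Variables (G : zmodType) (phi : G -> L).
Hypothesis phi_inj : injective phi.

(** The p-adic distance from [g] to the initial segment of G cut at [a] is at most p^-n. *)
Definition near (g : G) (n : nat) (a : L) : Prop :=
  exists2 g', lt (phi g') a & exists w, g - g' = w *+ p ^ n.

(* s n is the largest b such that g is p^(n+1)-far from the elements below c i (n, b);
   this recovers s from g. *)
Definition realizes (i : I) (g : G) (s : nat -> mu) : Prop :=
  forall n, ~ near g n.+1 (c i (n, s n)) /\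
    forall b, lt (c i (n, s n)) (c i (n, b)) -> near g n.+1 (c i (n, b)).

Lemma c_lt i n b b' : ltm b b' -> lt (c i (n, b)) (c i (n, b')).
Proof. by move=> h; apply: c_incr; right. Qed.

Lemma realizes_fun i g s s' : realizes i g s -> realizes i g s' -> s = s'.
Proof.
move=> gs gs'; apply/funext => n.
have [far up] := gs n; have [far' up'] := gs' n.
case: (swo_tot wom (s n) (s' n)) => // /(c_lt i n) h.
  by case: far'; apply: up.
by case: far; apply: up'.
Qed.

Lemma realizes_ex : exists s : I -> nat -> mu, forall i g, ~ realizes i g (s i).
Proof.
have /choice[s sP] : forall i, exists s, forall g, ~ realizes i g s.
  move=> i; apply: (unrealized (@realizes_fun i) (ex_intro _ phi phi_inj)).
  exact: L_lt_power.
by exists s.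
Qed.

Variable s : I -> nat -> mu.
Hypothesis s_unrealized : forall i g, ~ realizes i g (s i).

Definition pt i n : L := c i (n, s i n).

Lemma pt_lt i m n : (m < n)%N -> lt (pt i m) (pt i n).
Proof. by move=> h; apply: c_incr; left. Qed.

Lemma pt_inj i : injective (pt i).
Proof.
move=> m n e; case: (ltngtP m n) => // /(pt_lt i); rewrite e => /(swo_irr wo) [].
Qed.

Definition delta (x : L) : L -> rat := fun y => if pselect (y = x) then 1 else 0.

(* the function representing the p-adic limit of sum_n p^n delta (pt i n) *)
Definition limit_elt (i : I) : L -> rat := fun x =>
  if pselect (exists n, x = pt i n) is left h then (p ^ projT1 (cid h))%:R else 0.

Lemma deltaE x : delta x x = 1.
Proof. by rewrite /delta; case: pselect. Qed.

Lemma delta0 x y : y <> x -> delta x y = 0.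
Proof. by rewrite /delta; case: pselect. Qed.

Lemma limit_eltE i n : limit_elt i (pt i n) = (p ^ n)%:R.
Proof.
rewrite /limit_elt; case: pselect => [h|[]]; last by exists n.
by case: (cid h) => m /= /pt_inj ->.
Qed.

Lemma limit_elt0 i x : (forall n, x <> pt i n) -> limit_elt i x = 0.
Proof. by move=> h; rewrite /limit_elt; case: pselect => // k; exfalso; case: k => n /h. Qed.

Definition gen (z : L + I) : L -> rat :=
  match z with inl x => delta x | inr i => limit_elt i end.

Local Notation H := (lattice p_prime gen).

Lemma delta_ex : exists e : L -> H, forall x, lat_val (e x) = delta x.
Proof.
have /choice[e eP] : forall x, exists h : H, lat_val h = delta x.
  move=> x; apply: lat_mk; first exact: (in_span_gen _ (inl x)).
  move=> y; have [->|yx] := pselect (y = x); last by rewrite delta0 //; apply: dv0.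
  by rewrite deltaE; apply: (dv_exp p_prime (leqnn 0)).
by exists e.
Qed.

Lemma limit_ex : exists y : I -> H, forall i, lat_val (y i) = limit_elt i.
Proof.
have /choice[y yP] : forall i, exists h : H, lat_val h = limit_elt i.
  move=> i; apply: lat_mk; first exact: (in_span_gen _ (inr i)).
  move=> x; have [[n ->]|/forallNP no] := pselect (exists n, x = pt i n).
    by rewrite limit_eltE; apply: dv_exp.
  by rewrite limit_elt0 //; apply: dv0.
by exists y.
Qed.

(** Removing the first [m] terms of the series leaves only coefficients p^n with n at least [m]. *)
Lemma tail_dv i m x :
  dv p m (limit_elt i x - \sum_(k < m) delta (pt i k) x * (p ^ k)%:R).
Proof.
have [[n ->]|/forallNP no] := pselect (exists n, x = pt i n); last first.
  rewrite limit_elt0 // big1 => [|k _]; first by rewrite subrr; apply: dv0.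
  by rewrite delta0 ?mul0r.
rewrite limit_eltE; have [nm|mn] := ltnP n m.
  rewrite (bigD1 (Ordinal nm)) //= deltaE mul1r big1 ?addr0 ?subrr; first exact: dv0.
  by move=> k kn; rewrite delta0 ?mul0r // => /pt_inj nk; case/eqP: kn; apply: val_inj.
rewrite big1 ?subr0 => [|k _]; first exact: dv_exp.
rewrite delta0 ?mul0r // => /pt_inj nk.
by move: (ltn_ord k); rewrite -nk ltnNge mn.
Qed.

(** Each generator has countable support, countable sets are bounded in L, and elements are finite
    combinations of generators. *)
Lemma support_bounded (h : H) : exists x, forall y, lat_val h y <> 0 -> lt y x.
Proof.
have genb z : exists x, forall y, gen z y <> 0 -> lt y x.
  case: z => [x|i] /=.
    have [x' [xx' _]] := above2 reg L_uncountable x x.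
    by exists x' => y; have [->|yx] := pselect (y = x); [|rewrite delta0].
  have [x xP] := @reg _ (pt i) L_uncountable; exists x => y.
  by have [[n ->]|/forallNP no] := pselect (exists n, y = pt i n); [|rewrite limit_elt0].
have [t tE] := lat_span h.
suff [x xP] : exists x, forall y, \sum_(t <- t) t.1 * gen t.2 y <> 0 -> lt y x.
  by exists x => y; rewrite tE; apply: xP.
elim: t {tE} => [|[q z] t [x xP]].
  by case: L_inf => u _; exists (u 0%N) => y; rewrite big_nil.
have [x' x'P] := genb z; have [w [xw x'w]] := above2 reg L_uncountable x x'.
exists w => y; rewrite big_cons /=.
have [/x'P yx' _|/contrapT ->] := pselect (gen z y <> 0).
  exact: (swo_trans wo) x'w.
by rewrite mulr0 add0r => /xP yx; apply: (swo_trans wo) xw.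
Qed.

(** [f w] is chosen above all [F b x y] with x and y at most [w]; regularity allows these suprema,
    taken over [b], then y, then x. *)
Lemma closure_binary (B : Type) (F : B -> L -> L -> L) : embeds B nat ->
  exists f, forall a, closure_points lt f a ->
    forall b x y, lt x a -> lt y a -> lt (F b x y) a.
Proof.
move=> Bnat; have nB : ~ embeds L B by move=> h; apply: L_uncountable; apply: embeds_trans Bnat.
have one (K : L -> L) x : exists z, forall y, ~ lt x y -> lt (K y) z.
  have [z1 z1P] := @reg _ (fun y : {y | lt y x} => K (sval y)) (@segL x).
  have [z [z1z Kz]] := above2 reg L_uncountable z1 (K x).
  exists z => y /(swo_nlt wo)[->//|yx]; apply: (swo_trans wo) z1z.
  exact: (z1P (exist _ y yx)).
have /choice[f1 f1P] : forall x, exists z, forall b, lt (F b x x) z.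
  by move=> x; apply: reg.
have /choice[K KP] : forall xy : L * L, exists z, forall b, lt (F b xy.1 xy.2) z.
  by move=> xy; apply: (@reg _ (fun b => F b xy.1 xy.2)).
have /choice[row rowP] : forall xy : L * L, exists z, forall y, ~ lt xy.1 y -> lt (K (xy.2, y)) z.
  by move=> [x' x]; apply: (one (fun y => K (x, y))).
have /choice[f fP] : forall w, exists z, forall x, ~ lt w x -> lt (row (w, x)) z.
  by move=> w; apply: (one (fun x => row (w, x))).
exists f => a fa b x y xa ya.
have [w [wa wx wy]] : exists w, [/\ lt w a, ~ lt w x & ~ lt w y].
  case: (swo_tot wo x y) => [xy|xy|yx]; [exists y|exists y|exists x]; split=> //;
    rewrite ?xy; by [apply: (swo_irr wo)|apply: (swo_asym wo)].
apply: (swo_trans wo) (fa w wa); apply: (swo_trans wo) (fP w x wx).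
by apply: (swo_trans wo) (rowP (w, x) y wy); apply: (KP (x, y)).
Qed.

(** At a guessed index [i] the element [h (y i)] would realize [s i]. *)
Lemma lattice_not_pure (h : {additive H -> G}) : ~ pure_embedding h.
Proof.
move=> [hinj hpure].
have [e eP] := delta_ex; have [y yP] := limit_ex.
have /choice[bd bdP] := support_bounded.
(* [u (g, n)] is an element of H whose image is congruent to g modulo p^n, if there is one. *)
have /choice[u uP] : forall gn : G * nat, exists u : H,
    (exists u' w, h u' - gn.1 = w *+ p ^ gn.2) -> exists w, h u - gn.1 = w *+ p ^ gn.2.
  by move=> gn; have [[u' [w uw]]|no] := pselect (exists u' w, h u' - gn.1 = w *+ p ^ gn.2);
    [exists u' => _; exists w|exists 0 => /no].
have /choice[psi psiP] : forall x, exists g, (exists g', phi g' = x) -> phi g = x.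
  by move=> x; have [[g gx]|no] := pselect (exists g, phi g = x); [exists g|exists 0 => /no].
have psiK g : psi (phi g) = g by apply/phi_inj/psiP; exists g.
(* Closure of a cut under [F] means three things: the approximants [u] of earlier elements of G have
   support below it, and the earlier elements of G contain the images of p^k times earlier basis
   elements and are closed under sums. *)
pose F (b : nat + nat + unit) (x x' : L) := match b with
  | inl (inl n) => bd (u (psi x, n))
  | inl (inr k) => phi (h (e x *+ p ^ k))
  | inr tt => phi (psi x + psi x') end.
have [f fP] : exists f, forall a, closure_points lt f a ->
    forall b x y, lt x a -> lt y a -> lt (F b x y) a.
  apply: closure_binary; apply: embeds_sum; [exact: embeds_refl| |].
    by apply: embeds_sum; apply: embeds_refl.
  by exists (fun _ => 0%N) => -[] [].
have [i iP] := c_guess f; apply: (@s_unrealized i (h (y i))) => n.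
have ygap m : exists v, y i - \sum_(k < m) e (pt i k) *+ p ^ k = v *+ p ^ m.
  apply: lat_divide => x; rewrite lat_valB lat_val_sum yP.
  under eq_bigr => k _ do rewrite lat_valMn eP.
  exact: tail_dv.
split.
(* Far: an earlier g' close to [h (y i)] has an approximant [u], and purity makes [y i - u]
   divisible by p^(n+1). But [u] vanishes at [pt i n], where [y i] has coefficient p^n. *)
- move=> [g' g'lt [w gw]]; have ha := fP _ (iP (n, s i n)).
  have [w' uw'] := uP (g', n.+1) (ex_intro _ (y i) (ex_intro _ w gw)).
  have [v vE] : exists v, y i - u (g', n.+1) = v *+ p ^ n.+1.
    apply: (hpure _ _ (w - w')).
    by rewrite raddfB mulrnBl -gw -uw' /= opprB addrA subrK.
  have u0 : lat_val (u (g', n.+1)) (pt i n) = 0.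
    apply: contrapT => /bdP; apply: (swo_asym wo).
    by have := ha (inl (inl n.+1)) _ _ g'lt g'lt; rewrite /F psiK.
  have := congr1 (fun h => lat_val h (pt i n)) vE.
  rewrite lat_valB u0 yP limit_eltE subr0 lat_valMn => E.
  have := dv_natmul p_prime n.+1 (lat_dv v (pt i n)); rewrite add0n -E.
  by move=> /(dv_exp_leq p_prime); rewrite ltnn.
(* Near: the points [pt i k] with k at most n lie below [a], so the image of the partial sum up to n
   is enumerated before [a]. *)
- move=> b; set a := c i (n, b) => na; have ha := fP _ (iP (n, b)).
  have sumlt m : (m <= n)%N -> lt (phi (h (\sum_(k < m.+1) e (pt i k) *+ p ^ k))) a.
    have term k : (k <= n)%N -> lt (phi (h (e (pt i k) *+ p ^ k))) a.
      rewrite leq_eqVlt => kn; have ka : lt (pt i k) a.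
        case/orP: kn => [/eqP -> //|/(pt_lt i) kn]; exact: (swo_trans wo) na.
      exact: (ha (inl (inr k)) _ _ ka ka).
    elim: m => [|m IH] mn; first by rewrite big_ord1; apply: term.
    rewrite big_ord_recr /= raddfD.
    by have := ha (inr tt) _ _ (IH (ltnW mn)) (term _ mn); rewrite /F !psiK.
  exists (h (\sum_(k < n.+1) e (pt i k) *+ p ^ k)); first exact: sumlt.
  by have [v vE] := ygap n.+1; exists (h v); rewrite -raddfB vE raddfMn.
Qed.

End UncountableBase.

(** * The case of a finite base *)

Section Padic.
Variables (p : nat) (p_prime : prime p).

(** [s] lists the digits, all 0 or 1, of a p-adic integer; this is its truncation modulo p^n. *)
Fixpoint padic_sum (s : nat -> bool) (n : nat) : nat :=
  if n is m.+1 then (padic_sum s m + s m * p ^ m)%N else 0%N.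

Lemma padic_sum_tail s m n : (m <= n)%N ->
  exists t, padic_sum s n = (padic_sum s m + t * p ^ m)%N.
Proof.
elim: n => [|n IH]; first by rewrite leqn0 => /eqP ->; exists 0%N; rewrite mul0n addn0.
rewrite leq_eqVlt => /orP[/eqP ->|]; first by exists 0%N; rewrite mul0n addn0.
rewrite ltnS => mn; have [t tE] := IH mn; exists (t + s n * p ^ (n - m))%N.
by rewrite /= tE mulnDl -mulnA -expnD subnK // addnA.
Qed.

Lemma padic_sum_eq s s' k : (forall j, (j < k)%N -> s j = s' j) ->
  padic_sum s k = padic_sum s' k.
Proof.
elim: k => //= k IH ss'; rewrite IH ?ss' // => j jk.
by apply: ss'; apply: ltnW.
Qed.

Lemma first_difference (s s' : nat -> bool) : s <> s' ->
  exists k, (forall j, (j < k)%N -> s j = s' j) /\ s k <> s' k.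
Proof.
move=> ss'; have ex : exists k, s k != s' k.
  apply: contrapT => /forallNP no; apply: ss'; apply/funext => k.
  by have /negP := no k; rewrite negbK => /eqP.
have [k /eqP sk kmin] := ex_minnP ex; exists k; split=> // j jk; apply/eqP.
by apply: contraLR jk; rewrite -leqNgt; apply: kmin.
Qed.

(* The p-adic sum x of s satisfies x g.1 = g.2 in the p-adic completion of G, resp.
   x = - z.1 / z.2. *)
Definition realized_in (G : zmodType) (g : G * G) (s : nat -> bool) : Prop :=
  (~ exists w, g.1 = w *+ p) /\
  forall n, exists w, g.2 - g.1 *+ padic_sum s n = w *+ p ^ n.

Definition rational_sum (z : rat * rat) (s : nat -> bool) : Prop :=
  z.2 <> 0 /\ forall m, exists N, forall n, (N <= n)%N ->
    dv p m (z.1 + z.2 * (padic_sum s n)%:R).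

(** By symmetry, at the first difference [k] one may assume that the digit of [s] is 1 and that of
    [s'] is 0. *)
Lemma fun_of_half (R : (nat -> bool) -> Prop) :
  (forall s s' k, R s -> R s' -> (forall j, (j < k)%N -> s j = s' j) ->
     s k -> ~~ s' k -> False) ->
  forall s s', R s -> R s' -> s = s'.
Proof.
move=> half s s' Rs Rs'; apply: contrapT => /first_difference[k [ss' sk]].
case: (boolP (s k)) => h; case: (boolP (s' k)) => h'.
- by apply: sk; rewrite h h'.
- exact: (half s s' k).
- by apply: (half s' s k) => // j /ss'.
- by apply: sk; rewrite (negbTE h) (negbTE h').
Qed.

(** Subtracting the congruences modulo p^(k+1) shows that p^(k+1) divides p^k times [g.1];
    torsion-freeness then makes [g.1] divisible by p. *)
Lemma realized_in_fun (G : zmodType) (g : G * G) : torsion_free G ->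
  forall s s', realized_in g s -> realized_in g s' -> s = s'.
Proof.
move=> tf; apply: fun_of_half => s s' k [np gs] [_ gs'] ss' sk s'k; apply: np.
have [w wE] := gs k.+1; have [w' w'E] := gs' k.+1; exists (w' - w).
apply/eqP; rewrite -subr_eq0; apply/eqP; apply: (tf (p ^ k)%N).
  by rewrite expn_gt0 prime_gt0.
rewrite mulrnBl -mulrnA -expnS mulrnBl -wE -w'E /= (padic_sum_eq ss') sk (negbTE s'k).
by rewrite mul1n mul0n addn0 mulrnDr (opprD (_ *+ padic_sum _ _)) addrA subKr subrr.
Qed.

(** Late truncations differ by p^k times an integer e congruent to 1 modulo p. So every power of p
    divides p^k times [z.2] in Z_(p), contradicting that [z.2] is nonzero. *)
Lemma rational_sum_fun (z : rat * rat) :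
  forall s s', rational_sum z s -> rational_sum z s' -> s = s'.
Proof.
apply: fun_of_half => s s' k [z0 zs] [_ zs'] ss' sk s'k.
have : z.2 * (p ^ k)%:R = 0.
  apply: (dv_eq0 p_prime) => m; have [N NP] := zs m; have [N' N'P] := zs' m.
  pose n := (N + N' + k.+1)%N.
  have := dv_sub p_prime (NP n _) (N'P n _).
  have [t ->] := @padic_sum_tail s k.+1 n (leq_addl _ _).
  have [t' ->] := @padic_sum_tail s' k.+1 n (leq_addl _ _).
  rewrite /= (padic_sum_eq ss') sk (negbTE s'k) /n.
  move=> /(_ ltac:(lia) ltac:(lia)) [a [d [pd E]]].
  pose e : int := 1 + p%:Z * (t%:Z - t'%:Z).
  (* The unit [e] moves into the denominator, which is a natural number; the sign goes to the
     numerator. *)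
  exists (a * Num.sg e), (d * `|e|)%N.
  split.
    rewrite Euclid_dvdM // negb_or pd /=.
    have -> : (p %| `|e|)%N = (p%:Z %| e)%Z by [].
    by rewrite /e rpredDr ?dvdz_mulr // dvdzE /= Euclid_dvd1.
  have -> : (d * `|e|)%:R = d%:R * (e%:~R * (Num.sg e)%:~R) :> rat.
    by rewrite natrM; congr (_ * _); rewrite -rmorphM /= mulrC -normrEsg -abszE.
  rewrite [(a * _)%:~R]rmorphM /= [RHS]mulrA -E /e rmorphD rmorphM rmorphB /= -!pmulrn.
  by rewrite !natrD !natrM expnS natrM; ring.
move=> /eqP; rewrite mulf_eq0 (negbTE (expp_neq0 p_prime k)) orbF => /eqP.
exact: z0.
Qed.

Variable s : nat -> bool.

(* (u, v) stands for u + v x, where x is the p-adic sum of s *)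
Definition padic_pred : {pred rat^o * rat^o} :=
  [pred z | `[< exists N, forall n, (N <= n)%N -> dv p 0 (z.1 + z.2 * (padic_sum s n)%:R) >]].

Lemma padic_closed : zmod_closed padic_pred.
Proof.
split; first by apply/asboolP; exists 0%N => n _; rewrite /= mul0r addr0; apply: dv0.
move=> [u v] [u' v'] /asboolP[N NP] /asboolP[N' N'P]; apply/asboolP.
exists (N + N')%N => n nN /=.
have := dv_sub p_prime (NP n _) (N'P n _).
move=> /(_ (leq_trans (leq_addr _ _) nN) (leq_trans (leq_addl _ _) nN)) /=.
by congr dv; ring.
Qed.

(** If u + v x is divisible by all powers of p, then v = 0 because x is irrational, and then u =
    0. *)
Lemma padic_reduced : (forall z, ~ rational_sum z s) ->
  reduced_module p (subgroup_type padic_closed).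
Proof.
move=> irr; apply: (reduced_submodule p_prime).
- move=> d [u v] pd /asboolP[N NP]; apply/asboolP; exists N => n /NP /(dv_div p_prime pd) /=.
  by congr dv; rewrite /GRing.scale /=; ring.
- move=> [u v] h.
  have uv m : exists N, forall n, (N <= n)%N -> dv p m (u + v * (padic_sum s n)%:R).
    have /asboolP[N NP] := h m; exists N => n /NP /= hn.
    apply/(dv_shift p_prime 0 m); move: hn; congr dv; rewrite /GRing.scale /=. ring.
  have v0 : v = 0 by apply: contrapT => v0; apply: (irr (u, v)).
  have u0 : u = 0.
    apply: (dv_eq0 p_prime) => m; have [N NP] := uv m.
    by have := NP N (leqnn N); rewrite v0 mul0r addr0.
  by rewrite u0 v0.
Qed.

(** The images of 1 and x would realize [s]: purity keeps the image of 1 indivisible by p, and x is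
    congruent to its truncations. *)
Lemma padic_not_pure (K G : zmodType) (h : {additive K * subgroup_type padic_closed -> G}) :
  (forall g : G * G, ~ realized_in g s) -> ~ pure_embedding h.
Proof.
move=> nos [hinj hpure].
have mk (z : rat^o * rat^o) : z \in padic_pred ->
    exists k : subgroup_type padic_closed, val k = z.
  by move=> zP; exists (Sub z zP); rewrite SubK.
have [|a aE] := mk (1, 0).
  by apply/asboolP; exists 0%N => n _; rewrite /= mul0r addr0; apply: (dv_exp p_prime (leqnn 0)).
have nat_dv n : dv p 0 n%:R.
  by exists n, 1%N; rewrite dvdn1 neq_ltn prime_gt1 // orbT expn0 mul1r mulr1.
have [|b bE] := mk (0, 1).
  by apply/asboolP; exists 0%N => n _; rewrite /= mul1r add0r.
apply: (nos (h (0, a), h (0, b))); split=> /=.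
- move=> [w /hpure[[k a'] E]].
  have : a = a' *+ p by have := congr1 snd E; rewrite raddfMn.
  move=> /(congr1 val); rewrite aE raddfMn => E'.
  have {E'} : (1, 0) = p%:R *: val a' by rewrite scaler_nat.
  move: (val a') (valP a' : val a' \in padic_pred) => [u v].
  move=> /asboolP[N /(_ N (leqnn N)) /= uv] [u1 /esym/eqP].
  rewrite scaler_eq0 pnatr_eq0 -leqn0 leqNgt prime_gt0 //= => /eqP v0.
  move: uv; rewrite v0 mul0r addr0 => /(dv_natmul p_prime 1); rewrite expn1 mulrC -[_ * u]u1 add0n.
  by move=> /(@dv_exp_leq _ p_prime 1 0).
- move=> n; set X := padic_sum s n.
  (* This element is (x - X) / p^n. *)
  have [|k kE] := mk ((p ^ n)%:R^-1 * - X%:R, (p ^ n)%:R^-1).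
    apply/asboolP; exists n => m nm /=; have [t ->] := padic_sum_tail s nm.
    have -> : (p ^ n)%:R^-1 * - X%:R + (p ^ n)%:R^-1 * (X + t * p ^ n)%:R
       = t%:R * ((p ^ n)%:R^-1 * (p ^ n)%:R) :> rat by rewrite natrD natrM; ring.
    by rewrite mulVf ?expp_neq0 // mulr1.
  exists (h (0, k)); rewrite -!raddfMn -raddfB /=; congr (h _).
  have E : b - a *+ X = k *+ p ^ n.
    apply: val_inj; rewrite raddfB !raddfMn /= aE bE kE !pair_mulrn /=.
    congr (_, _) => /=.
      by rewrite add0r mulNrn -[RHS]mulr_natl mulVKf ?expp_neq0.
    by rewrite oppr0 mul0rn addr0 -[RHS]mulr_natl mulfV ?expp_neq0.
  by rewrite !pair_mulrn /= -E mul0rn; congr (_, _); rewrite mul0rn subr0.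
Qed.

End Padic.

(** * Modules without pure embedding into a given group, in both cases *)

Lemma exists_nonpure_small (p : nat) (p_prime : prime p) (L : Type) (G : zmodType) :
  embeds nat L -> ~ embeds (nat -> bool) L -> torsion_free G -> embeds G L ->
  exists H : zmodType, [/\ reduced_module p H, embeds H L, embeds L H &
    forall h : {additive H -> G}, ~ pure_embedding h].
Proof.
move=> L_inf L_small tf GL.
(* The digit sequence must avoid both the pairs of G and the rationals: at most |L| conditions, each
   excluding at most one sequence. *)
pose R (w : G * G + rat * rat) s := match w with
  | inl g => realized_in p g s | inr z => rational_sum p z s end.
have ratL : embeds (rat * rat) L.
  by apply: embeds_trans L_inf; exists pickle; apply: pcan_inj pickleK.
have [||s sP] := @unrealized _ _ L R _ _ L_small.
- by move=> [g|z] s s'; [apply: realized_in_fun|apply: rational_sum_fun].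
- by apply: embeds_sum => //; apply: embeds_prodW.
(* The free summand [K] raises the cardinality to |L|. *)
pose K := lattice p_prime (@delta L); pose P := subgroup_type (padic_closed p_prime s).
exists (K * P)%type; split.
- apply: reduced_module_prod; first exact: lattice_reduced.
  by apply: padic_reduced => z; apply: (sP (inr z)).
- apply: embeds_prodW => //; first by apply: embeds_lattice => //; apply: embeds_refl.
  by apply: embeds_trans ratL; exists val; apply: val_inj.
- have /choice[e eP] : forall x, exists h : K, lat_val h = delta x.
    move=> x; apply: lat_mk; first exact: in_span_gen.
    move=> y; rewrite /delta; case: pselect => [yx|yx]; last exact: dv0.
    exact: (dv_exp p_prime (leqnn 0)).
  exists (fun x => (e x, 0)) => x y [/(congr1 (fun h => lat_val h x))].
  by rewrite !eP /delta; case: pselect => // xx; case: pselect.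
- by move=> h; apply: padic_not_pure => g; apply: (sP (inl g)).
Qed.

Lemma exists_nonpure_large (p : nat) (p_prime : prime p) (L mu mu_plus : Type) (G : zmodType) :
  regular_cardinal L -> embeds nat mu -> embeds mu mu_plus -> ~ embeds mu_plus mu ->
  embeds mu_plus L -> ~ embeds L mu_plus -> ~ embeds (nat -> mu) L -> embeds G L ->
  exists H : zmodType, [/\ reduced_module p H, embeds H L, embeds L H &
    forall h : {additive H -> G}, ~ pure_embedding h].
Proof.
move=> [/infiniteP/card_leTP L_inf [R [[Rwo Rinit] Rreg]]] mu_inf mu_le mu_lt Ml_le Ml_lt L_pow.
move=> [phi phi_inj].
pose lt x y := R x y /\ x <> y.
have wo : strict_wo lt by apply: swo_well_order.
have segL x : ~ embeds L {y | lt y x}.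
  have [_ nle] := Rinit x; apply: contra_not nle => h.
  apply: card_le_trans (_ : [set: {y | lt y x}] #<= _); first exact/card_leTP.
  apply: card_le_trans (_ : range (@proj1_sig L (lt^~ x)) #<= _); last first.
    by apply: subset_card_le => _ [[y yx] _ <-].
  have /card_eqPle[] // : range (@proj1_sig L (lt^~ x)) #= [set: {y | lt y x}].
  by apply: inj_card_eq => -[a ha] [b hb] _ _ /= ab; apply: eq_exist.
(* An unbounded family has a cofinal range, which has cardinality |L| by regularity. *)
have reg (A : Type) (g : A -> L) : ~ embeds L A -> exists x, forall a, lt (g a) x.
  move=> LA; apply: contrapT => /forallNP unb; apply: LA; apply/card_leTP.
  have /Rreg /card_eqPle[_ h] : cofinal R (range g).
    move=> x; have /existsNP[a ga] := unb x; exists (g a); first by exists a.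
    have [<-|[]//] := proj1 (swo_nlt wo _ _) ga.
    have [|z [[/asboolP zE zmin] _]] := Rwo [pred y | `[< y = x >]].
      by exists x; apply/asboolP.
    by rewrite -{1}zE; apply: zmin; apply/asboolP.
  exact: card_le_trans h (card_image_le g [set: A]).
have L_unc : ~ embeds L nat.
  by move=> h; apply: Ml_lt; apply: embeds_trans h (embeds_trans mu_inf mu_le).
(* Such a cut exists because a copy of mu^+ in L is bounded; the segment below the least one serves
   as M. *)
have [x0 x0_big x0_least] : exists2 x0, ~ embeds {y | lt y x0} mu &
    forall y, ~ embeds {z | lt z y} mu -> ~ lt y x0.
  apply: (swo_least wo); apply: contrapT => /forallNP small; apply: mu_lt.
  have [j ji] := Ml_le; have [x xP] := reg _ j Ml_lt.
  have /contrapT := small x; apply: embeds_trans.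
  exists (fun m => exist (lt^~ x) (j m) (xP m)) => m m' [] /ji //.
pose M := {y | lt y x0}; pose ltM (a b : M) := lt (sval a) (sval b).
have woM : strict_wo ltM.
  by apply: (swo_pull wo) => -[a ha] [b hb] /= ab; exact: eq_exist.
have segM (a : M) : embeds {b | ltM b a} mu.
  have h : embeds {z | lt z (sval a)} mu.
    by apply: contrapT => /x0_least; apply; apply: (proj2_sig a).
  apply: embeds_trans h.
  exists (fun b : {b | ltM b a} => exist (lt^~ (sval a)) (sval (sval b)) (proj2_sig b)).
  by move=> [[b hb] hb'] [[d hd] hd'] /= [bd]; apply: eq_exist; exact: eq_exist.
have [//|mu_le_M] := embeds_total M mu.
have [ltm wom] := swo_exists mu.
have [c [c_incr c_guess]] := club_guessing wo woM wom reg segL mu_inf segM x0_big mu_le_M (@segL x0).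
have [s sP] := realizes_ex p wom c_incr L_pow phi_inj.
exists (lattice p_prime (gen p c s)); split.
- exact: lattice_reduced.
- apply: embeds_lattice => //; apply: embeds_sum => //; first exact: embeds_refl.
  by apply: embeds_prodW => //; [exact: embeds_refl|exact: embeds_sval].
- have [e eP] := delta_ex p_prime c s; exists e => x y /(congr1 (fun h => lat_val h x)).
  by rewrite !eP deltaE /delta; case: pselect.
- exact: (lattice_not_pure wo reg segL L_inf L_unc c_incr c_guess phi_inj sP).
Qed.

Theorem theorem3p8 (lambda mu mu_plus : Type)
  (lambda_regular : regular_cardinal lambda)
  (mu_plusP : successor_cardinal mu mu_plus)
  (mu_plus_lt_lambda : card_lt [set: mu_plus] [set: lambda])
  (lambda_lt_power : card_lt [set: lambda] [set: nat -> mu])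
  (p : nat) (p_prime : prime p) :
  (forall G : zmodType,
     tf_homogeneous (p_type p) G -> [set: G] #= [set: lambda] ->
     exists H : zmodType,
       [/\ tf_homogeneous (p_type p) H, [set: H] #= [set: lambda] &
           ~ isomorphic_to_pure_subgroup H G]) /\
  ~ (exists G : zmodType,
       purely_universal (tf_homogeneous (p_type p)) lambda G).
Proof.
have main (G : zmodType) : tf_homogeneous (p_type p) G -> [set: G] #= [set: lambda] ->
     exists H : zmodType,
       [/\ tf_homogeneous (p_type p) H, [set: H] #= [set: lambda] &
           ~ isomorphic_to_pure_subgroup H G].
  move=> [tf _] /card_eqPle[/card_leTP G_le _].
  have L_inf : embeds nat lambda by case: lambda_regular => /infiniteP/card_leTP.
  have [Ml_le Ml_lt] := mu_plus_lt_lambda; have [_ L_pow] := lambda_lt_power.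
  have [[mu_le mu_lt] _] := mu_plusP.
  suff [H [Hred HL LH Hpure]] : exists H : zmodType, [/\ reduced_module p H,
      embeds H lambda, embeds lambda H & forall h : {additive H -> G}, ~ pure_embedding h].
    exists H; split; first exact: (reduced_module_tf_homogeneous p_prime).
      by apply: Cantor_Bernstein; apply/card_leTP.
    by move=> /pure_subgroup_embedding[h /Hpure].
  have [mu_inf|mu_fin] := pselect (embeds nat mu).
    by apply: (@exists_nonpure_large _ _ _ mu mu_plus) => //; rewrite -?card_leTP.
  apply: exists_nonpure_small => // small; apply: L_pow; apply/card_leTP.
  apply: embeds_trans small.
  have [//|[f fi]] := embeds_total nat mu.
  (* A sequence of natural numbers is coded by the indicator function of its graph. *)
  exists (fun s n => if unpickle n is Some ij then f (s ij.1) == ij.2 else false) => s s' ss'.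
  apply/funext => i; apply: fi; apply/esym/eqP.
  by have := congr1 (fun t => t (pickle (i, f (s i)))) ss'; rewrite /= pickleK eqxx /= => <-.
split=> // -[G [KG GL univ]]; have [H [KH /card_eqPle[HL _] nH]] := main G KG GL.
exact/nH/univ.
Qed.
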